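(* Let $G$ be a non-archimedean Polish group. Then $G$ is extremely amenable if and only if every continuous action of $G$ on the Cantor set $D^{\aleph_0}=\{0,1\}^{\aleph_0}$ has a fixed point.
   Context: A Polish group is a topological group whose topology is separable and completely metrizable. A topological group is non-archimedean if it is Hausdorff and has a base of neighbourhoods of the identity element consisting of open subgroups. A continuous action of a topological group $G$ on a topological space $X$ is a group action for which the map $G\times X\to X$, $(g,x)\mapsto gx$, is jointly continuous; a fixed point is a point $x\in X$ with $gx=x$ for all $g\in G$. A topological group $G$ is called extremely amenable if every continuous action of $G$ on a (nonempty) compact Hausdorff space has a fixed point. *)

(* Defs.v *)
From HB Require Import structures.
From mathcomp Require Import all_boot all_order all_algebra.
From mathcomp Require Import all_classical all_reals all_analysis.

Set Implicit Arguments.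
Unset Strict Implicit.
Unset Printing Implicit Defensive.

Import Order.TTheory GRing.Theory Num.Theory.
Import numFieldTopology.Exports.

Local Open Scope classical_set_scope.
Local Open Scope group_scope.

HB.structure Definition PreTopologicalGroup := {G of Topological G & Group G}.

HB.mixin Record PreTopologicalGroup_isTopologicalGroup G
    & PreTopologicalGroup G := {
  mulg_continuous : continuous (fun p : G * G => p.1 * p.2) ;
  invg_continuous : continuous (fun x : G => x^-1)
}.

#[short(type="topologicalGroupType")]
HB.structure Definition TopologicalGroup :=
  {G of PreTopologicalGroup G & PreTopologicalGroup_isTopologicalGroup G}.

Definition separable_space (T : topologicalType) : Prop :=
  exists2 D : set T, countable D & dense D.

(* [metricType] bundles a metric with its topology; metrizability is a property
   of the given topology, so the metric is existential, with the axioms of the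
   factory [isMetric]. *)
Definition completely_metrizable (R : realType) (T : topologicalType) : Prop :=
  exists d : T -> T -> R,
    [/\ forall x, d x x = 0%R,
        forall x y, d x y = 0%R -> x = y,
        forall x y, d x y = d y x &
        forall y x z, (d x z <= d x y + d y z)%R] /\
    (forall x, nbhs x = nbhs_ball_ (fun y e => [set z | (d y z < e)%R]) x) /\
    (forall u : nat -> T,
      (forall e : R, (0 < e)%R ->
        \forall m & n \near \oo, (d (u m) (u n) < e)%R) ->
      exists l : T, u @ \oo --> l).

Definition polish (R : realType) (T : topologicalType) : Prop :=
  separable_space T /\ completely_metrizable R T.

Definition non_archimedean (G : topologicalGroupType) : Prop :=
  hausdorff_space G /\
  forall U : set G, nbhs 1 U ->
    exists H : set G, [/\ open H, group_closed (mem H) & H `<=` U].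

Section actions.
Variables (G : topologicalGroupType) (X : topologicalType).
Implicit Type act : G -> X -> X.

Definition group_action act : Prop :=
  (forall x, act 1 x = x) /\
  (forall g h x, act (g * h) x = act g (act h x)).

Definition continuous_action act : Prop :=
  group_action act /\ continuous (fun p : G * X => act p.1 p.2).

Definition has_fixed_point act : Prop := exists x, forall g, act g x = x.

End actions.

Definition extremely_amenable (G : topologicalGroupType) : Prop :=
  forall X : topologicalType,
    [set: X] !=set0 -> compact [set: X] -> hausdorff_space X ->
    forall act : G -> X -> X, continuous_action act -> has_fixed_point act.

(* Main.v *)
Require Import Defs.
From HB Require Import structures.
From mathcomp Require Import all_boot all_order all_algebra.
From mathcomp Require Import all_classical all_reals all_analysis.

(** Let every action of [G] on the Cantor space have a fixed point, and let [G]
    act on a compact Hausdorff space [X] with base point [x0].  For an open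
    subgroup [H], left [H]-invariant sets are 2-colourings of the countable set
    [H\G].  The closure of the orbit of a sequence of such colourings under right
    translation is a compact metrizable zero-dimensional flow, and its product
    with the trivial flow on the Cantor space is homeomorphic to the Cantor
    space.  A fixed point in the orbit closure consists of constant colourings,
    so for every finite [F] and finitely many of the colourings [C] some [g]
    satisfies [f g \in C <-> g \in C] for all [f \in F].  Hence these conditions,
    over all [H], [C] and [F], generate a proper filter on [G].  Every cluster
    point [x] of its image under [g |-> g x0] is fixed: by joint continuity,
    any neighbourhood of [x] contains [C x0] for an [H]-invariant [C] that
    contains all [g] with [g x0] close to [x]. *)

Set Implicit Arguments.
Unset Strict Implicit.
Unset Printing Implicit Defensive.

Local Open Scope classical_set_scope.
Local Open Scope group_scope.

(** * Products and subspaces of compact, perfect and zero-dimensional spaces *)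

Lemma zero_dimensional_hausdorff (T : topologicalType) :
  zero_dimensional T -> hausdorff_space T.
Proof.
move=> zT x y xy; apply: contrapT => /eqP /zT[U [[oU cU] Ux nUy]].
have nU : nbhs x U by apply: open_nbhs_nbhs.
have nV : nbhs y (~` U).
  by apply: open_nbhs_nbhs; split=> //; apply: closed_openC.
by have [z []] := xy _ _ nU nV.
Qed.

Lemma zero_dimensional_setX (S T : topologicalType) :
  zero_dimensional S -> zero_dimensional T -> zero_dimensional (S * T)%type.
Proof.
move=> zS zT [x y] [x' y']; have [<-|xx' _] := eqVneq x x'.
  rewrite xpair_eqE eqxx => /zT[U [cU Uy nUy]].
  exists (snd @^-1` U); split=> //.
  by apply: preimage_clopen => // z; apply: cvg_snd.
have [U [cU Ux nUx]] := zS _ _ xx'.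
exists (fst @^-1` U); split=> //.
by apply: preimage_clopen => // z; apply: cvg_fst.
Qed.

(** The second projection is open, so an isolated point of the product would yield one of [T]. *)
Lemma perfect_setX (S T : topologicalType) :
  perfect_set [set: T] -> perfect_set [set: (S * T)%type].
Proof.
move=> /perfectTP pT; apply/perfectTP => -[x y] /snd_open.
by rewrite image_set1; apply: pT.
Qed.

Lemma compact_set_type (T : topologicalType) (A : set T) :
  compact A -> compact [set: A].
Proof.
move=> cA F PF _.
have [|x [Ax Fx]] := cA ((set_val : A -> T) @ F) _.
  by apply: (@filterS _ F _ setT) filterT => z _; apply: set_valP.
exists (exist _ x (mem_set Ax)); split=> // B C FB [_ [[D oD <-] Dx DC]].
have [||z [[w Bw <-] Dw]] := Fx (set_val @` B) D.
- by apply: (@filterS _ F _ B) FB => w Bw; exists w.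
- exact: open_nbhs_nbhs.
by exists w; split=> //; apply: DC.
Qed.

Lemma zero_dimensional_set_type (T : topologicalType) (A : set T) :
  zero_dimensional T -> zero_dimensional A.
Proof.
move=> zT x y xy; have /zT[U [cU Ux nUy]] : set_val x != set_val y.
  by apply: contra_neq xy => /val_inj.
exists (set_val @^-1` U); split=> //.
by apply: preimage_clopen => //; apply: initial_continuous.
Qed.

Lemma continuous_action_setXl (G : topologicalGroupType)
    (X Y : topologicalType) (act : G -> X -> X) :
  continuous_action act ->
  continuous_action (fun g (p : X * Y) => (act g p.1, p.2)).
Proof.
move=> [[act1 actM] cact]; split.
  by split=> [[x c]|g h [x c]] /=; rewrite ?act1 ?actM.
move=> p; apply: cvg_pair => /=.
  apply: (@continuous_comp _ _ _ (fun p : G * (X * Y) => (p.1, p.2.1))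
    (fun p => act p.1 p.2)); last exact: cact.
  apply: cvg_pair => /=; first exact: cvg_fst.
  by apply: (@cvg_comp _ _ _ snd fst _ _ _ cvg_snd); apply: cvg_fst.
by apply: (@cvg_comp _ _ _ snd snd _ _ _ cvg_snd); apply: cvg_snd.
Qed.

(** * From the Cantor space to compact zero-dimensional flows *)

Section zero_dimensional_flows.
Context {R : realType} {G : topologicalGroupType}.
Hypothesis cantor_fixed : forall act : G -> cantor_space -> cantor_space,
  continuous_action act -> has_fixed_point act.

(** By Brouwer's characterization [T] is homeomorphic to the Cantor space; the action is conjugated
    by the homeomorphism and the fixed point carried back. *)
Lemma cantor_like_fixed (T : pseudoPMetricType R) (act : G -> T -> T) :
  cantor_like T -> continuous_action act -> has_fixed_point act.
Proof.
move=> /homeomorphism_cantor_like[f [cf clf]] [[act1 actM] cact].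
have fK : cancel f f^-1%FUN by move=> x; apply: funK; rewrite inE.
have fVK : cancel f^-1%FUN f by move=> x; apply: invK; rewrite inE.
have cfV : continuous f^-1%FUN.
  apply/continuous_closedP => A /clf; congr closed.
  apply/seteqP; split=> [_ [x Ax <-] | y Ay] /=; rewrite ?fK//.
  by exists (f^-1%FUN y).
have [|x fx] := cantor_fixed (act := fun g x => f^-1%FUN (act g (f x))).
  split; first by split=> [x|g h x]; rewrite ?act1 ?actM ?fK ?fVK.
  move=> p; apply: (@continuous_comp _ _ _ (fun p => act p.1 (f p.2)) f^-1%FUN).
    apply: (@continuous_comp _ _ _ (fun p : G * cantor_space => (p.1, f p.2))
      (fun p => act p.1 p.2)); last exact: cact.
    apply: cvg_pair => /=; first exact: cvg_fst.
    by apply: (@cvg_comp _ _ _ snd f _ _ _ cvg_snd); apply: cf.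
  exact: cfV.
by exists (f x) => g; rewrite -[in RHS](fx g) fVK.
Qed.

(* The trivial flow on the Cantor space as a factor removes isolated points *)
Lemma zero_dimensional_fixed (X : pseudoMetricType R) (act : G -> X -> X) :
  [set: X] !=set0 -> compact [set: X] -> zero_dimensional X ->
  continuous_action act -> has_fixed_point act.
Proof.
move=> [x0 _] cX zX actX.
pose T := (X * cantor_space)%type.
pose ptT := isPointed.Build T (x0, point).
pose PT : pseudoPMetricType R := HB.pack T ptT.
pose actT (g : G) (p : PT) : PT := (act g p.1, p.2).
have [_ cC _ zC] := cantor_like_cantor_space.
have zT : zero_dimensional T := zero_dimensional_setX zX zC.
have [||[x c] xcP] := @cantor_like_fixed PT actT.
- split.
  + by have := @perfect_setX X _ cantor_perfect.
  + by have := compact_setX cX cC; rewrite setXTT.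
  + exact: zero_dimensional_hausdorff.
  + exact: zT.
- exact: (continuous_action_setXl cantor_space actX).
by exists x => g; have [] := xcP g.
Qed.

End zero_dimensional_flows.

(** * Separate continuity and pointwise convergence *)

Section slices.
Context {S T U : topologicalType} (f : S -> T -> U).
Hypothesis cf : continuous (fun p : S * T => f p.1 p.2).

Lemma continuous_slicel x : continuous (f x).
Proof.
move=> y A /(@cf (x, y))[[B C] /= [xB yC] BCA].
apply: filterS yC => z Cz.
by apply: (BCA (x, z)); split=> //; apply: nbhs_singleton.
Qed.

Lemma continuous_slicer y : continuous (f ^~ y).
Proof.
move=> x A /(@cf (x, y))[[B C] /= [xB yC] BCA].
apply: filterS xB => z Bz.
by apply: (BCA (z, y)); split=> //; apply: nbhs_singleton.
Qed.

End slices.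

Lemma mulgl_continuous (G : topologicalGroupType) (x : G) :
  continuous (fun y => x * y).
Proof.
apply: (@continuous_slicel _ _ _ (fun x y : G => x * y)).
exact: mulg_continuous.
Qed.

Lemma mulgr_continuous (G : topologicalGroupType) (x : G) :
  continuous (fun y => y * x).
Proof.
apply: (@continuous_slicer _ _ _ (fun x y : G => x * y)).
exact: mulg_continuous.
Qed.

Lemma continuous_ptws (T U : topologicalType) (I : Type)
    (f : T -> {ptws I -> U}) :
  (forall i, continuous (fun t => f t i)) -> continuous f.
Proof.
move=> cf t; apply/cvg_sup => i A [_ [[B oB <-] Bft] /filterS]; apply.
by apply: (cf i t); apply: open_nbhs_nbhs.
Qed.

Lemma near_ptws_eq (I : eqType) (T : discreteTopologicalType)
    (z : {ptws I -> T}) (s : seq I) :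
  nbhs z [set w : {ptws I -> T} | {in s, w =1 z}].
Proof.
elim: s => [|i s IHs]; first by apply: filterS filterT => w _ j.
have zi : nbhs z [set w : {ptws I -> T} | w i = z i].
  apply: (@proj_continuous _ (fun=> T) i z [set t | t = z i]).
  by apply: open_nbhs_nbhs; split=> //; apply: discrete_open.
apply: filterS (filterI zi IHs) => w [wi ws] j.
by rewrite inE => /predU1P[->//|/ws].
Qed.

(** * The shift flow on colourings of cosets *)

Definition left_invariant (G : groupType) (H C : set G) :=
  forall h x, H h -> C x -> C (h * x).

Section coset_shift.
Context {G : topologicalGroupType}.
Variables (H : set G) (e : nat -> G).
Hypotheses (openH : open H) (groupH : group_closed (mem H)).
Hypothesis e_dense : forall U : set G, open U -> U !=set0 -> exists n, U (e n).

Let H1 : H 1. Proof. by case: groupH => /set_mem. Qed.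

Let HV x : H x -> H x^-1.
Proof. by move=> /mem_set /(group_closedV groupH) /set_mem. Qed.

Let HM x y : H x -> H y -> H (x * y).
Proof.
by move=> /mem_set Hx /mem_set Hy; apply/set_mem/(group_closedM groupH).
Qed.

(** [H (e n * x^-1)] says that [e n] lies in the right coset [H x]. The choice made by [xget]
    depends only on this set of indices, hence only on the coset. *)
Definition coset_index (x : G) : nat := xget 0 [set n | H (e n * x^-1)].

Lemma coset_indexP x : H (e (coset_index x) * x^-1).
Proof.
have [n Hn] : exists n, H (e n * x^-1).
  apply: (e_dense (U := (fun y => y * x^-1) @^-1` H)); last first.
    by exists x; rewrite /= mulgV.
  apply: open_comp => // y _.
  exact: mulgr_continuous.
by rewrite /coset_index; case: xgetP => [m _ //|/(_ n)].
Qed.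

Lemma coset_index_eq x y : H (x * y^-1) -> coset_index x = coset_index y.
Proof.
move=> Hxy; congr (xget _ _); apply/seteqP; split=> n /= Hn.
  by have := HM Hn Hxy; rewrite mulgA mulgVK.
by have := HM Hn (HV Hxy); rewrite invgF mulgA mulgVK.
Qed.

Lemma coset_index_mul x g :
  coset_index (e (coset_index x) * g) = coset_index (x * g).
Proof. by apply: coset_index_eq; rewrite mulgKA; apply: coset_indexP. Qed.

Lemma coset_index_continuous g :
  \forall g' \near g, coset_index g' = coset_index g.
Proof.
have : nbhs g ((fun y => y * g^-1) @^-1` H).
  apply: open_nbhs_nbhs; split; last by rewrite /= mulgV.
  apply: open_comp => // y _.
  exact: mulgr_continuous.
by apply: filterS => y; apply: coset_index_eq.
Qed.

Notation colouring := {ptws (nat * nat)%type -> bool}.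

(* The index [n] stands for the coset [H (e n)], so cosets are numbered with
   repetitions: [1] fixes the points of [translate_closure], not every point. *)
Definition coset_shift (g : G) (z : colouring) : colouring :=
  fun p => z (coset_index (e p.1 * g), p.2).

(** Coordinate [(n, i)] of the image reads a single coordinate [(m, i)] of [z], and [m] is locally
    constant in the group element because right cosets of [H] are open. *)
Lemma coset_shift_continuous :
  continuous (fun p : G * colouring => coset_shift p.1 p.2).
Proof.
apply: continuous_ptws => -[n i] [g z]; rewrite /coset_shift /=.
set m := coset_index (e n * g).
have eg : \forall g' \near g, coset_index (e n * g') = m.
  have := @mulgl_continuous _ (e n) g.
  by move=> /(_ _ (coset_index_continuous (e n * g))).
apply: cvg_near_cst.
exists ([set g' | coset_index (e n * g') = m],
        [set w : colouring | w (m, i) = z (m, i)]).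
  split=> //=; apply: filterS (near_ptws_eq z [:: (m, i)]) => w; apply.
  by rewrite inE.
by case=> g' w /= [-> ->].
Qed.

Variable c : nat -> set G.
Hypothesis cH : forall i, left_invariant H (c i).

(** [x] and its representative lie in one right coset of [H], also after multiplication by [y] on
    the right, and [c i] is a union of such cosets. *)
Lemma coset_colour i x y : c i (e (coset_index x) * y) <-> c i (x * y).
Proof.
split=> cxy.
  have := cH (HV (coset_indexP x)) cxy.
  by rewrite invgF mulgA mulgVK.
have := cH (coset_indexP x) cxy.
by rewrite mulgA mulgVK.
Qed.

Definition translate (g : G) : colouring := fun p => `[< c p.2 (e p.1 * g) >].

Definition translate_closure : set colouring := closure (range translate).

Lemma translate_closureP z (s : seq (nat * nat)) : translate_closure z ->
  exists g, {in s, z =1 translate g}.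
Proof.
move=> Zz; have [_ [[g _ <-] gz]] := Zz _ (near_ptws_eq z s).
by exists g => p /gz.
Qed.

(** Thus the translates form one orbit, and by continuity the shifts preserve its closure. *)
Lemma coset_shift_translate g h :
  coset_shift g (translate h) = translate (g * h).
Proof.
apply/funext => -[n i]; apply/asbool_equiv_eq => /=.
by rewrite [e n * (g * h)]mulgA; apply: coset_colour.
Qed.

Lemma coset_shift_stable g z :
  translate_closure z -> translate_closure (coset_shift g z).
Proof.
move=> Zz B nB.
have cg := continuous_slicel (f := coset_shift)
  (@coset_shift_continuous) (x := g).
have [_ [[h _ <-] Bh]] := Zz _ (cg z _ nB).
by exists (translate (g * h)); split=> //; rewrite -coset_shift_translate.
Qed.

(** A translate takes equal values at all indices of one coset, and [z] agrees with some translate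
    at the two indices compared. *)
Lemma coset_shift1 z : translate_closure z -> coset_shift 1 z = z.
Proof.
move=> Zz; apply/funext => -[n i]; rewrite /coset_shift /= mulg1.
have [g zg] := translate_closureP [:: (coset_index (e n), i); (n, i)] Zz.
rewrite !zg ?inE ?eqxx ?orbT//.
by apply/asbool_equiv_eq; apply: coset_colour.
Qed.

Lemma coset_shiftM g h z :
  coset_shift (g * h) z = coset_shift g (coset_shift h z).
Proof.
by apply/funext => -[n i]; rewrite /coset_shift /= coset_index_mul mulgA.
Qed.

Definition closure_shift (g : G) (z : translate_closure) : translate_closure :=
  exist _ (coset_shift g (set_val z))
    (mem_set (@coset_shift_stable g _ (set_valP z))).

Lemma closure_shift_continuous_action : continuous_action closure_shift.
Proof.
split.
  split=> [z|g h z]; apply: val_inj => /=.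
    exact/coset_shift1/set_valP.
  exact: coset_shiftM.
have cf : continuous (fun p : G * translate_closure =>
    coset_shift p.1 (set_val p.2)).
  move=> [g z] A /(@coset_shift_continuous (g, set_val z)).
  move=> [[B C] /= [gB zC] BCA].
  exists (B, set_val @^-1` C).
    by split=> //; apply: initial_continuous.
  by case=> h w [/= Bh Cw]; apply: (BCA (h, set_val w)).
move=> p U [_ [[W oW <-] Wp /filterS]]; apply; apply: cf.
exact: open_nbhs_nbhs.
Qed.

End coset_shift.

(** * From fixed colourings to fixed points in compact spaces *)

Section fixed_points.
Context {R : realType} {G : topologicalGroupType}.
Hypothesis separableG : separable_space G.
Hypothesis cantor_fixed : forall act : G -> cantor_space -> cantor_space,
  continuous_action act -> has_fixed_point act.

Lemma separable_dense_seq : exists e : nat -> G,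
  forall U : set G, open U -> U !=set0 -> exists n, U (e n).
Proof.
have [D /countable_injP[f finj] dD] := separableG.
(* The sequence inverts an injection of [D] into the naturals, with value [1] off its range. *)
exists (fun n => xget 1 [set x | D x /\ f x = n]) => U oU U0.
have [x [Ux Dx]] := dD _ U0 oU.
exists (f x); case: xgetP => [y _ [Dy fyx]|/(_ x)[]//].
by rewrite (finj y x) ?inE.
Qed.

(** A fixed point of the orbit closure does not depend on the coset; a translate that agrees with it
    at the finitely many cosets and colours involved provides [g]. *)
Lemma equicoloured_translate (H : set G) (c : nat -> set G)
    (s : seq G) (k : nat) :
  open H -> group_closed (mem H) -> (forall i, left_invariant H (c i)) ->
  exists g, forall f i, f \in s -> (i < k)%N -> c i (f * g) <-> c i g.
Proof.
move=> oH gH cH; have [e e_dense] := separable_dense_seq.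
pose idx := coset_index H e.
have [|||z zP] := zero_dimensional_fixed (R := R) cantor_fixed _ _ _
  (closure_shift_continuous_action oH gH e_dense cH).
- have Zz : translate_closure e c (translate e c 1).
    by apply: subset_closure; exists 1.
  by exists (exist (fun z => z \in translate_closure e c) _ (mem_set Zz)).
- apply: compact_set_type; apply: (@subclosed_compact _ _ setT) => //.
    exact: closed_closure.
  have := @tychonoff _ (fun _ : nat * nat => _) _ (fun=> bool_compact).
  by congr (compact _); rewrite eqEsubset.
- apply: zero_dimensional_set_type; apply: zero_dimension_prod => _.
  exact: discrete_zero_dimension.
have [w Zw shift_w] : exists2 w : {ptws (nat * nat)%type -> bool},
    translate_closure e c w & forall g, coset_shift H e g w = w.
  exists (set_val z); first exact: set_valP.
  by move=> g; exact: (congr1 set_val (zP g)).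
(* Right translation is transitive on cosets: the shift by this element carries the coset of [1] to
   that of [f]. *)
have wE f i : w (idx f, i) = w (idx 1, i).
  by rewrite -[in RHS](shift_w ((e (idx 1))^-1 * f)) /coset_shift /= mulVKg.
have [g wg] := translate_closureP
  [seq (idx f, i) | f <- 1 :: s, i <- iota 0 k] Zw.
have colE f i : f \in 1 :: s -> (i < k)%N -> c i (f * g) <-> w (idx 1, i).
  move=> fs ik; rewrite -(wE f) wg; last first.
    by apply: allpairs_f => //; rewrite mem_iota.
  have colfg := coset_colour oH gH e_dense cH i f g.
  by split=> [/colfg cfg|/asboolP /colfg//]; apply/asboolP.
exists g => f i fs ik; rewrite -[X in _ <-> c i X]mul1g.
by rewrite colE ?colE// ?mem_head// inE fs orbT.
Qed.

Lemma cantor_fixed_extremely_amenable :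
  non_archimedean G -> extremely_amenable G.
Proof.
move=> [_ naG] X [x0 _] cX hX act [[act1 actM] cact].
(* A triple holds a subgroup, a finite set of translations and a list of colourings. The default
   [setT] is invariant and makes the condition trivial past the end of the list. *)
pose admissible (t : set G * seq G * seq (set G)) := [/\ open t.1.1,
  group_closed (mem t.1.1) & forall i, left_invariant t.1.1 (nth setT t.2 i)].
pose B (t : set G * seq G * seq (set G)) := [set g | forall f i,
  f \in t.1.2 -> nth setT t.2 i (f * g) <-> nth setT t.2 i g].
have FB : ProperFilter (filter_from admissible B).
  apply: filter_from_proper; last first.
    move=> [[H s] c] [/= oH gH cH].
    have [g gP] := equicoloured_translate s (size c) oH gH cH.
    exists g => f i /= fs; have [ic|ci] := ltnP i (size c); first exact: gP.
    by rewrite nth_default.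
  apply: filter_from_filter.
    exists ([set: G], [::], [::]); split=> /=; first exact: openT.
      by split=> [|x y _ _]; rewrite in_setT.
    by move=> i h x _; rewrite nth_nil.
  move=> [[H s] c] [[H' s'] c'] [/= oH [H1 HV] cH] [/= oH' [H'1 H'V] cH'].
  (* Sets invariant under [H] or under [H'] are invariant under the intersection. *)
  exists (H `&` H', s ++ s', c ++ c').
    split=> /=; first exact: openI.
      split=> [|x y]; first by rewrite in_setI H1.
      by rewrite !in_setI => /andP[/HV Hx /H'V H'x] /andP[/Hx-> /H'x->].
    move=> i h x [Hh H'h]; rewrite nth_cat.
    by case: ifP => _; [apply: cH|apply: cH'].
  move=> g /= gP; split=> f i fs.
    have [ic|ci] := ltnP i (size c); last by rewrite nth_default.
    by have := gP f i; rewrite mem_cat fs nth_cat ic; apply.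
  have := gP f (size c + i)%N.
  by rewrite mem_cat fs orbT nth_cat ltnNge leq_addr addKn; apply.
have [|x [_ Fx]] := cX ((act^~ x0) @ filter_from admissible B) _.
  exact: filterT.
exists x => f; apply/esym/hX => V W Vx Wfx.
have [[U V'] /= [nU nV'] UV'V] :
    nbhs ((1, x) : G * X) [set p | V (act p.1 p.2)].
  by apply: cact; rewrite /= act1.
have [H [oH gH HU]] := naG _ nU.
(* The [H]-saturation of the elements that send [x0] into [V']; since [H] lies in [U], its elements
   still send [x0] into [V]. *)
pose C := [set g | exists h g', [/\ H h, V' (act g' x0) & g = h * g']].
have CH : left_invariant H C.
  move=> h _ Hh [h' [g' [Hh' Vg' ->]]]; exists (h * h'), g'; split=> //.
    by apply/set_mem/(group_closedM gH); apply/mem_set.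
  by rewrite mulgA.
have CV g : C g -> V (act g x0).
  move=> [h [g' [Hh Vg' ->]]]; rewrite actM.
  by apply: (UV'V (h, _)); split=> //; apply: HU.
have cf : continuous (act f) by apply: continuous_slicel cact f.
have [||y [[g gP <-] [V'g Wfg]]] :=
  Fx (act^~ x0 @` B (H, [:: f], [:: C])) (V' `&` act f @^-1` W).
- exists (H, [:: f], [:: C]); last by move=> g gB; exists g.
  split=> // -[|i] //=; last by rewrite nth_nil.
- by apply: filterI => //; apply: cf.
(* This point lies in [W] by the choice of [g], and in [V] because [g], hence also [f * g], belongs
   to [C]. *)
exists (act (f * g) x0); split; last by rewrite actM.
apply: CV; apply/(gP f 0%N); first by rewrite inE.
by exists 1, g; split; [apply/set_mem; case: gH| |rewrite mul1g].
Qed.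

End fixed_points.

Theorem mainTheorem3 (R : realType) (G : topologicalGroupType)
    (G_polish : polish R G) (G_nonarch : non_archimedean G) :
  extremely_amenable G <->
  (forall act : G -> cantor_space -> cantor_space,
     continuous_action act -> has_fixed_point act).
Proof.
split=> [eaG act|cG].
  apply: eaG; first by exists point.
    exact: cantor_space_compact.
  exact: cantor_space_hausdorff.
exact: (cantor_fixed_extremely_amenable (R := R) G_polish.1 cG).
Qed.
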